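(* Let $\Lambda$ be a finite dimensional algebra over a field, let $0\to A\to B\to C\to0$ be a short exact sequence in $\mathrm{mod}\,\Lambda$, let $k>1$ be an integer and $n$ a nonnegative integer. If $k\text{-}\operatorname{edell}A\le n-1$ and $(k-1)\text{-}\operatorname{dell}B\le n$, then $(k-1)\text{-}\operatorname{edell}C\le n$.
   Context: $\mathrm{mod}\,\Lambda$ is the category of finitely generated right $\Lambda$-modules. $\mathbb N$ is the set of nonnegative integers; the infimum of the empty set is $+\infty$. $\Omega M$ is the kernel of a projective cover of $M$, $\Omega^0M=M$, $\Omega^{n+1}M=\Omega(\Omega^nM)$. ''$U$ is a direct summand of $V$ up to projective summands'' means that $U$ is isomorphic to a direct summand of $V\oplus P$ for some projective $P$. For an integer $k\ge1$: $k\text{-}\operatorname{dell}M$ is the infimum of all $n\in\mathbb N$ such that $\Omega^nM$ is a direct summand of $\Omega^{n+k}N$ up to projective summands for some $N\in\mathrm{mod}\,\Lambda$; and $k\text{-}\operatorname{edell}M$ is the infimum of all $n\in\mathbb N$ such that for every integer $k'\ge1$ and every right $\Lambda$-module $X$ of injective dimension $\mathrm{id}\,X=n+k-1+k'$ one has $\mathrm{Ext}_\Lambda^{n+k'}(M,X)=0$. *)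

(* Defs.v *)
From HB Require Import structures.
From mathcomp Require Import all_boot all_order all_algebra all_field.
From mathcomp Require Import boolp constructive_ereal.

Set Implicit Arguments.
Unset Strict Implicit.
Unset Printing Implicit Defensive.

Import Order.TTheory GRing.Theory Num.Theory.
Local Open Scope ring_scope.

(* Infimum of a set of natural numbers, with inf of the empty set = +oo.
   The values live in \bar int so that they can be compared with n - 1 also
   when n = 0. *)
Definition inf_nat (P : nat -> Prop) : \bar int :=
  match pselect (exists n, `[< P n >]) with
  | left exP => (Posz (ex_minn exP))%:E
  | right _ => +oo%E
  end.

(* Everything below is stated for left modules over an arbitrary ring R.
   Right modules over L are obtained as left modules over the converse ring
   L^c. *)
Section Modules.
Variable R : nzRingType.

Definition fin_gen (M : lmodType R) : Prop :=
  exists (m : nat) (g : 'I_m -> M),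
    forall x : M, exists c : 'I_m -> R, x = \sum_(i < m) c i *: g i.

Definition surjective (M N : Type) (f : M -> N) : Prop :=
  forall y, exists x, f x = y.

Definition exact_at (L M N : lmodType R)
    (f : {linear L -> M}) (g : {linear M -> N}) : Prop :=
  forall y : M, g y = 0 <-> exists x : L, f x = y.

Definition short_exact (L M N : lmodType R)
    (f : {linear L -> M}) (g : {linear M -> N}) : Prop :=
  [/\ injective f, exact_at f g & surjective g].

Definition isomorphic (M N : lmodType R) : Prop :=
  exists f : {linear M -> N}, bijective f.

Definition is_summand (U V : lmodType R) : Prop :=
  exists W : lmodType R, isomorphic (U * W)%type V.

Definition projective (P : lmodType R) : Prop :=
  forall (M N : lmodType R) (g : {linear M -> N}) (f : {linear P -> N}),
    surjective g -> exists h : {linear P -> M}, forall x, g (h x) = f x.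

Definition injective_module (I : lmodType R) : Prop :=
  forall (M N : lmodType R) (g : {linear M -> N}) (f : {linear M -> I}),
    injective g -> exists h : {linear N -> I}, forall x, h (g x) = f x.

Definition summand_up_to_proj (U V : lmodType R) : Prop :=
  exists P : lmodType R, projective P /\ is_summand U (V * P)%type.

(* ker f is a superfluous submodule of P: S + ker f = P implies S = P. *)
Definition superfluous_ker (P M : lmodType R) (f : {linear P -> M}) : Prop :=
  forall S : {pred P}, submod_closed S ->
    (forall x : P, exists s t : P, [/\ s \in S, f t = 0 & x = s + t]) ->
    forall x : P, x \in S.

Definition projective_cover (P M : lmodType R) (f : {linear P -> M}) : Prop :=
  [/\ projective P, surjective f & superfluous_ker f].

(* Projective covers, hence syzygies, are only determined up to isomorphism;
   is_syzygy M K means that K is a kernel of some projective cover of M. *)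
Definition is_syzygy (M K : lmodType R) : Prop :=
  exists (P : lmodType R) (i : {linear K -> P}) (f : {linear P -> M}),
    projective_cover f /\ short_exact i f.

Fixpoint is_nth_syzygy (n : nat) (M K : lmodType R) : Prop :=
  match n with
  | 0 => isomorphic K M
  | m.+1 => exists L : lmodType R, is_nth_syzygy m M L /\ is_syzygy L K
  end.

Record projective_resolution (M : lmodType R) := ProjectiveResolution {
  pr_obj : nat -> lmodType R;
  pr_d : forall i : nat, {linear pr_obj i.+1 -> pr_obj i};
  pr_aug : {linear pr_obj 0%N -> M};
  pr_projective : forall i, projective (pr_obj i);
  pr_aug_surj : surjective pr_aug;
  pr_exact0 : exact_at (pr_d 0%N) pr_aug;
  pr_exactS : forall i, exact_at (pr_d i.+1) (pr_d i) }.

Definition Ext_cocycle (M : lmodType R) (r : projective_resolution M)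
    (X : lmodType R) (i : nat) (f : {linear pr_obj r i -> X}) : Prop :=
  forall x, f (pr_d r i x) = 0.

Definition Ext_coboundary (M : lmodType R) (r : projective_resolution M)
    (X : lmodType R) (i : nat) : {linear pr_obj r i -> X} -> Prop :=
  match i return {linear pr_obj r i -> X} -> Prop with
  | 0 => fun f => forall x, f x = 0
  | j.+1 => fun f => exists g : {linear pr_obj r j -> X},
                       forall x, f x = g (pr_d r j x)
  end.

(* Ext^i(M, X) = H^i(Hom(P, X)) for a projective resolution P of M; its
   vanishing does not depend on P. *)
Definition Ext_eq0 (i : nat) (M X : lmodType R) : Prop :=
  exists r : projective_resolution M,
    forall f : {linear pr_obj r i -> X}, Ext_cocycle f -> Ext_coboundary f.

Record injective_resolution (X : lmodType R) := InjectiveResolution {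
  ir_obj : nat -> lmodType R;
  ir_d : forall i : nat, {linear ir_obj i -> ir_obj i.+1};
  ir_aug : {linear X -> ir_obj 0%N};
  ir_injective : forall i, injective_module (ir_obj i);
  ir_aug_inj : injective ir_aug;
  ir_exact0 : exact_at ir_aug (ir_d 0%N);
  ir_exactS : forall i, exact_at (ir_d i) (ir_d i.+1) }.

Definition inj_dim (X : lmodType R) : \bar int :=
  inf_nat (fun n => exists r : injective_resolution X,
    forall i, (n < i)%N -> forall x : ir_obj r i, x = 0).

Definition dell (k : nat) (M : lmodType R) : \bar int :=
  inf_nat (fun n => exists N K L : lmodType R,
    [/\ fin_gen N, is_nth_syzygy n M K, is_nth_syzygy (n + k) N L
      & summand_up_to_proj K L]).

Definition edell (k : nat) (M : lmodType R) : \bar int :=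
  inf_nat (fun n => forall (k' : nat) (X : lmodType R), (1 <= k')%N ->
    inj_dim X = (Posz (n + k - 1 + k'))%:E -> Ext_eq0 (n + k') M X).

End Modules.

(* Main.v *)
(* Let X have injective dimension n + k - 2 + k'.  In the exact sequence
   Ext^(n+k'-1)(A, X) -> Ext^(n+k')(C, X) -> Ext^(n+k')(B, X), the left term
   vanishes by the hypothesis on A.  If b <= n is such that Omega^b B is, up to
   projectives, a summand of Omega^(b+k-1) N, dimension shifting bounds the
   right term by Ext^(n+k'+k-1)(N, X), whose degree exceeds the injective
   dimension of X.  Everything is computed as H^i(Hom(-, I)) for an injective
   resolution I of X of minimal length, which makes exact sequences, summands
   and the last vanishing immediate; comparison with projective resolutions is
   only needed at A and C. *)

Require Import Defs.
From HB Require Import structures.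
From mathcomp Require Import all_boot all_order all_algebra all_field.
From mathcomp Require Import boolp constructive_ereal.
From mathcomp Require Import freeg zify.

Set Implicit Arguments.
Unset Strict Implicit.
Unset Printing Implicit Defensive.

Import Order.TTheory GRing.Theory Num.Theory.
Local Open Scope ring_scope.

(** * Factorization, kernels, lifting and extension of linear maps *)

Section LinearMaps.
Variable R : nzRingType.
Implicit Types L M N X : lmodType R.

Lemma linear_bundle M N (h : M -> N) :
  linear h -> exists h' : {linear M -> N}, h' =1 h.
Proof.
move=> hlin; pose mx := GRing.isLinear.Build R M N _ h hlin.
by exists (HB.pack h mx : {linear M -> N}).
Qed.

Lemma linear_factor M N X (g : {linear M -> N}) (f : {linear M -> X}) :
  surjective g -> (forall x, g x = 0 -> f x = 0) ->
  exists h : {linear N -> X}, forall x, h (g x) = f x.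
Proof.
move=> gsurj gf.
have [s gs] := choice gsurj.
have fE x y : g x = g y -> f x = f y.
  by move=> gxy; apply/subr0_eq; rewrite -linearB gf // linearB /= gxy subrr.
have [|h hE] := @linear_bundle N X (f \o s).
  by move=> a x y /=; rewrite -linearP; apply: fE; rewrite linearP !gs.
by exists h => x; rewrite hE; apply: fE; rewrite gs.
Qed.

Section Kernel.
Variables (M N : lmodType R) (g : {linear M -> N}).

Definition kernel_pred : {pred M} := [pred x | g x == 0].

Lemma kernel_submod_closed : submod_closed kernel_pred.
Proof.
split=> [|a x y]; rewrite !inE ?linear0 // => /eqP gx /eqP gy.
by rewrite linearP gx gy scaler0 addr0.
Qed.

HB.instance Definition _ :=
  GRing.isSubmodClosed.Build R M kernel_pred kernel_submod_closed.

Definition kernel := {x : M | x \in kernel_pred}.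
HB.instance Definition _ := SubChoice.on kernel.
HB.instance Definition _ := [SubChoice_isSubLmodule of kernel by <:].

Definition kernel_val : {linear kernel -> M} := val.

Lemma kernel_val_inj : injective kernel_val.
Proof. exact: val_inj. Qed.

Lemma kernel_exact : exact_at kernel_val g.
Proof.
move=> y; split=> [gy | [x <-]]; last by case: x => x /= /eqP.
have yK : y \in kernel_pred by rewrite inE gy.
by exists (Sub y yK); apply: SubK.
Qed.

Lemma kernel_lift L (f : {linear L -> M}) :
  (forall x, g (f x) = 0) ->
  exists h : {linear L -> kernel}, forall x, kernel_val (h x) = f x.
Proof.
move=> gf.
have /choice [h hE] x : exists y, kernel_val y = f x by apply/kernel_exact.
have [|h' h'E] := @linear_bundle L kernel h.
  by move=> a x y; apply: kernel_val_inj; rewrite linearP !hE linearP.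
by exists h' => x; rewrite h'E.
Qed.

End Kernel.

Arguments kernel_val {M N g}.

(** Exactness makes [f] map onto the kernel of [g], through which [u] factors. *)
Lemma projective_lift (P L M N : lmodType R)
    (f : {linear L -> M}) (g : {linear M -> N}) (u : {linear P -> M}) :
  projective P -> exact_at f g -> (forall x, g (u x) = 0) ->
  exists v : {linear P -> L}, forall x, f (v x) = u x.
Proof.
move=> projP fg gu.
have [u' u'E] := kernel_lift gu.
have [x|f' f'E] := @kernel_lift _ _ g _ f; first by apply/fg; exists x.
have [|v vE] := projP _ _ f' u'.
  move=> y; have [|x fx] := (fg (kernel_val y)).1.
    by apply/kernel_exact; exists y.
  by exists x; apply: kernel_val_inj; rewrite f'E.
by exists v => x; rewrite -f'E vE u'E.
Qed.

(* Exactness at [N] identifies the image of [M] with a kernel, from which the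
   factorization of [u] then extends by injectivity. *)
Lemma injective_extend (I M N O : lmodType R)
    (g : {linear M -> N}) (h : {linear N -> O}) (u : {linear M -> I}) :
  injective_module I -> exact_at g h -> (forall x, g x = 0 -> u x = 0) ->
  exists v : {linear N -> I}, forall x, v (g x) = u x.
Proof.
move=> injI gh gu.
have [x|g' g'E] := @kernel_lift _ _ h _ g; first by apply/gh; exists x.
have [||u' u'E] := @linear_factor _ _ _ g' u.
- move=> y; have [|x gx] := (gh (kernel_val y)).1.
    by apply/kernel_exact; exists y.
  by exists x; apply: kernel_val_inj; rewrite g'E.
- by move=> x g'x; apply: gu; rewrite -g'E g'x linear0.
have [v vE] := injI _ _ _ u' (@kernel_val_inj _ _ h).
by exists v => x; rewrite -g'E vE u'E.
Qed.

End LinearMaps.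

Arguments kernel_val {R M N g}.

(** * Free modules and existence of projective resolutions *)

Section FreeModules.
Variable R : nzRingType.

HB.instance Definition _ (K : choiceType) (M : lmodType R) (f : K -> M) :=
  GRing.isZmodMorphism.Build {freeg K / R} M (fglift f) (lift_is_additive f).

Lemma fglift_is_scalable (K : choiceType) (M : lmodType R) (f : K -> M) :
  scalable (fglift f : {freeg K / R} -> M).
Proof.
move=> c D; rewrite -[in RHS](freeg_sumE D) [c *: D]/(fgscale c D) !raddf_sum.
by apply: eq_bigr => x _; rewrite /= !liftU scalerA.
Qed.

HB.instance Definition _ (K : choiceType) (M : lmodType R) (f : K -> M) :=
  GRing.isScalable.Build R {freeg K / R} M _ (fglift f) (fglift_is_scalable f).

Lemma freeg_projective (K : choiceType) : projective ({freeg K / R} : lmodType R).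
Proof.
move=> M N g f gsurj.
have [s gs] := choice (fun k : K => gsurj (f << k >>)).
exists (fglift s : {linear _ -> _}) => D.
rewrite -(freeg_sumE D) !raddf_sum /=; apply: eq_bigr => x _.
have -> : << coeff x D *g x >> = coeff x D *: << x >> :> {freeg K / R}.
  by apply/eqP/freeg_eqP => y; rewrite coeffZ !coeffU mul1r.
by rewrite !linearZ /= liftU scale1r gs.
Qed.

Definition free_cover (M : lmodType R) : {linear {freeg M / R} -> M} := fglift id.

Lemma free_cover_surj M : surjective (free_cover M).
Proof. by move=> x; exists << x >>; rewrite /= liftU scale1r. Qed.

(** The cover is free on the whole underlying set, hence not minimal: it exists over any ring, and a
    witness for [Ext_eq0] only needs projective terms. *)
Fixpoint free_syzygy (M : lmodType R) (i : nat) : lmodType R :=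
  if i is j.+1 then kernel (free_cover (free_syzygy M j)) else M.

Definition free_resolution_d (M : lmodType R) (i : nat) :
    {linear {freeg (free_syzygy M i.+1) / R} -> {freeg (free_syzygy M i) / R}} :=
  kernel_val \o free_cover (free_syzygy M i.+1).

Lemma free_resolution_exact0 M :
  exact_at (free_resolution_d M 0) (free_cover M).
Proof.
move=> y; split=> [/kernel_exact [z <-]|[x <-]].
  by have [x <-] := free_cover_surj z; exists x.
by apply/kernel_exact; eexists.
Qed.

Lemma free_resolution_exactS M i :
  exact_at (free_resolution_d M i.+1) (free_resolution_d M i).
Proof.
move=> y; pose z := free_cover (free_syzygy M i.+1) y.
have -> : free_resolution_d M i y = kernel_val z by [].
rewrite -(@free_resolution_exact0 (free_syzygy M i.+1)) -/z.
split=> [zE|->]; last exact: linear0.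
by apply: kernel_val_inj; rewrite zE linear0.
Qed.

Definition free_resolution M : projective_resolution M :=
  ProjectiveResolution (fun i => @freeg_projective (free_syzygy M i))
    (@free_cover_surj M) (@free_resolution_exact0 M) (@free_resolution_exactS M).

End FreeModules.

(** * Vanishing of Ext through an injective resolution *)

Section ExtVanishing.
Variables (R : nzRingType) (X : lmodType R) (I : injective_resolution X).
Implicit Types K M N P U V W : lmodType R.

(* Vanishing of Ext^(i+1)(M, X), computed from the injective resolution [I] of
   [X]; note the shift of the index. *)
Definition inj_Ext_eq0 (i : nat) (M : lmodType R) : Prop :=
  forall f : {linear M -> ir_obj I i.+1}, (forall x, ir_d I i.+1 (f x) = 0) ->
  exists g : {linear M -> ir_obj I i}, forall x, ir_d I i (g x) = f x.

Lemma ir_dd i (x : ir_obj I i) : ir_d I i.+1 (ir_d I i x) = 0.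
Proof. by apply/ir_exactS; exists x. Qed.

Lemma inj_Ext_projective i P : projective P -> inj_Ext_eq0 i P.
Proof. by move=> projP f df; apply: projective_lift projP (@ir_exactS _ _ I i) df. Qed.

(** Diagram chase: a cocycle on [C] pulls back to some [d b] on [B]; then [b f] is a cocycle on [A],
    so equals [d a]. With [a'] extending [a] to [B], the map [b - d a'] vanishes on [A] and descends
    to [C]. *)
Lemma inj_Ext_ses i (A B C : lmodType R)
    (f : {linear A -> B}) (g : {linear B -> C}) :
  short_exact f g -> inj_Ext_eq0 i A -> inj_Ext_eq0 i.+1 B ->
  inj_Ext_eq0 i.+1 C.
Proof.
move=> [finj fg gsurj] extA extB c dc.
have [x /=|b bE] := extB (c \o g); first exact: dc.
have gf x : g (f x) = 0 by apply/fg; exists x.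
have [x /=|a aE] := extA (b \o f); first by rewrite bE /= gf linear0.
have [a' a'E] := @ir_injective _ _ I _ _ _ _ a finj.
have [x /fg[y <-] /=|v vE] := @linear_factor _ _ _ _ g (b \- (ir_d I i \o a')) gsurj.
  by rewrite a'E aE /= subrr.
exists v => z; have [x <-] := gsurj z.
by rewrite vE /= linearB /= ir_dd subr0 bE.
Qed.

(** For the direct implication, a cocycle on [K] extends to [f'] on [P], and [d f'] descends to a
    cocycle [v = d w] on [M]. Then [f' - w p] is a cocycle on [P], hence a coboundary, and restricts
    to the given one on [K]. *)
Lemma inj_Ext_syzygy i K P M (j : {linear K -> P}) (p : {linear P -> M}) :
  projective P -> short_exact j p ->
  inj_Ext_eq0 i.+1 M <-> inj_Ext_eq0 i K.
Proof.
move=> projP jp; split=> [extM f df | extK]; last first.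
  exact: inj_Ext_ses jp extK (inj_Ext_projective projP).
have [jinj jpE psurj] := jp.
have [f' f'E] := @ir_injective _ _ I _ _ _ _ f jinj.
have [x /jpE[y <-] /=|v vE] := @linear_factor _ _ _ _ p (ir_d I i.+1 \o f') psurj.
  by rewrite f'E df.
have [x|w wE] := extM v.
  by have [y <-] := psurj x; rewrite vE /= ir_dd.
have [x /=|u uE] := inj_Ext_projective projP (f := f' \- (w \o p)).
  by rewrite linearB /= wE vE /= subrr.
exists (u \o j) => x /=; rewrite uE /= f'E.
by have -> : p (j x) = 0; [apply/jpE; exists x | rewrite linear0 subr0].
Qed.

Lemma inj_Ext_retract i U V (s : {linear U -> V}) (r : {linear V -> U}) :
  cancel s r -> inj_Ext_eq0 i V -> inj_Ext_eq0 i U.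
Proof.
move=> srK extV f df; have [x /=|g gE] := extV (f \o r); first exact: df.
by exists (g \o s) => x; rewrite /= gE /= srK.
Qed.

Lemma inj_Ext_iso i M N :
  isomorphic M N -> inj_Ext_eq0 i M <-> inj_Ext_eq0 i N.
Proof.
move=> [f fbij].
(* Factoring the identity through [f] yields a linear inverse [h]. *)
have [x|x fx|h hK] := @linear_factor _ _ _ _ f (idfun : {linear M -> M}).
- by have [f' _ f'K] := fbij; exists (f' x).
- by apply: (bij_inj fbij); rewrite fx linear0.
split; last by apply: (@inj_Ext_retract _ _ _ f h) => x; apply: hK.
apply: (@inj_Ext_retract _ _ _ h f) => y.
by have [f' _ f'K] := fbij; rewrite -(f'K y) hK.
Qed.

Lemma inj_Ext_prod i V W :
  inj_Ext_eq0 i V -> inj_Ext_eq0 i W -> inj_Ext_eq0 i (V * W)%type.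
Proof.
move=> extV extW f df.
have [a x y|inl inlE] := @linear_bundle _ V (V * W)%type (fun x => (x, 0)).
  by congr (_, _); rewrite /= scaler0 addr0.
have [a x y|inr inrE] := @linear_bundle _ W (V * W)%type (fun x => (0, x)).
  by congr (_, _); rewrite /= scaler0 addr0.
have [x /=|g gE] := extV (f \o inl); first exact: df.
have [x /=|h hE] := extW (f \o inr); first exact: df.
exists ((g \o fst) \+ (h \o snd)) => -[x y] /=.
rewrite linearD /= gE hE /= -linearD inlE inrE.
by congr (f (_, _)); rewrite /= ?addr0 ?add0r.
Qed.

Lemma inj_Ext_summand i U V :
  is_summand U V -> inj_Ext_eq0 i V -> inj_Ext_eq0 i U.
Proof.
move=> [W /inj_Ext_iso <-].
have [a x y|inl inlE] := @linear_bundle _ U (U * W)%type (fun x => (x, 0)).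
  by congr (_, _); rewrite /= scaler0 addr0.
by apply: (@inj_Ext_retract _ _ _ inl fst) => x; rewrite inlE.
Qed.

Lemma inj_Ext_summand_up_to_proj i U V :
  summand_up_to_proj U V -> inj_Ext_eq0 i V -> inj_Ext_eq0 i U.
Proof.
move=> [P [projP /inj_Ext_summand sUV]] extV.
exact/sUV/inj_Ext_prod/inj_Ext_projective.
Qed.

(** Iterated dimension shifting. Both directions serve: from a syzygy up to [B], and from [N] down
    to its syzygy. *)
Lemma inj_Ext_nth_syzygy m i M K :
  is_nth_syzygy m M K -> inj_Ext_eq0 (i + m) M <-> inj_Ext_eq0 i K.
Proof.
elim: m i K => [|m IHm] i K /=.
  by rewrite addn0 => /inj_Ext_iso ->.
move=> [L [/IHm LM [P [j [p [[projP _ _] /(inj_Ext_syzygy i projP) <-]]]]]].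
by rewrite addnS -addSn LM.
Qed.

(** * Comparison with projective resolutions *)

Definition res_Ext_eq0 (M : lmodType R) (r : projective_resolution M) i :=
  forall f : {linear pr_obj r i -> X}, Ext_cocycle f -> Ext_coboundary f.

(** Zigzag in the double complex of maps from [r] to [I]. A cocycle on [M] lifts to
    [u : P_0 -> I^0], and [u d] lands in [X]; conversely a 1-cocycle into [X] extends to
    [u : P_0 -> I^0], and [d u] descends to [M]. In each case the bounding map obtained on the other
    side corrects [u]. *)
Lemma res_Ext1 M (r : projective_resolution M) :
  res_Ext_eq0 r 1 <-> inj_Ext_eq0 0 M.
Proof.
have augd x : pr_aug r (pr_d r 0 x) = 0 by apply/pr_exact0; exists x.
have daug x : ir_d I 0 (ir_aug I x) = 0 by apply/ir_exact0; exists x.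
split=> [extr f df | extM v vd].
  have [x /=|u uE] := projective_lift (u := f \o pr_aug r)
    (@pr_projective _ _ r 0) (@ir_exactS _ _ I 0); first exact: df.
  have [x /=|v vE] := projective_lift (u := u \o pr_d r 0)
    (@pr_projective _ _ r 1) (@ir_exact0 _ _ I); first by rewrite uE /= augd linear0.
  have [x|w wE] := extr v.
    apply: (@ir_aug_inj _ _ I); rewrite vE /= linear0.
    suff -> : pr_d r 0 (pr_d r 1 x) = 0 by rewrite linear0.
    by apply/pr_exactS; exists x.
  have [x /pr_exact0[y <-] /=|t tE] := @linear_factor _ _ _ _ (pr_aug r)
    (u \- (ir_aug I \o w)) (@pr_aug_surj _ _ r).
    by rewrite -wE vE /= subrr.
  exists t => z; have [x <-] := @pr_aug_surj _ _ r z.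
  by rewrite tE /= linearB /= daug subr0 uE.
have [x /pr_exactS[y <-] /=|u uE] := injective_extend (u := ir_aug I \o v)
  (@ir_injective _ _ I 0) (@pr_exact0 _ _ r); first by rewrite vd linear0.
have [x /pr_exact0[y <-] /=|f fE] := @linear_factor _ _ _ _ (pr_aug r)
  (ir_d I 0 \o u) (@pr_aug_surj _ _ r); first by rewrite uE /= daug.
have [z|t tE] := extM f.
  by have [x <-] := @pr_aug_surj _ _ r z; rewrite fE /= ir_dd.
have [x /=|w wE] := projective_lift (u := u \- (t \o pr_aug r))
  (@pr_projective _ _ r 0) (@ir_exact0 _ _ I).
  by rewrite linearB /= tE fE /= subrr.
exists w => x; apply: (@ir_aug_inj _ _ I).
by rewrite wE /= augd linear0 subr0 uE.
Qed.

(* The tail of a resolution of [M] resolves the kernel of the augmentation,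
   which shifts the degree down to the case of Ext^1. *)
Lemma res_ExtP i M (r : projective_resolution M) :
  res_Ext_eq0 r i.+1 <-> inj_Ext_eq0 i M.
Proof.
elim: i M r => [|i IHi] M r; first exact: res_Ext1.
have [x|d0 d0E] := @kernel_lift _ _ _ (pr_aug r) _ (pr_d r 0).
  by apply/pr_exact0; exists x.
have d0surj : surjective d0.
  move=> y; have [|x xE] := (@pr_exact0 _ _ r (kernel_val y)).1.
    by apply/kernel_exact; exists y.
  by exists x; apply: kernel_val_inj; rewrite d0E.
have d0exact : exact_at (pr_d r 1) d0.
  move=> y; rewrite -pr_exactS -d0E; split=> yE; first by rewrite yE linear0.
  by apply: kernel_val_inj; rewrite yE linear0.
have := IHi _ (ProjectiveResolution (fun i => @pr_projective _ _ r i.+1)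
  d0surj d0exact (fun i => @pr_exactS _ _ r i.+1)).
rewrite -(inj_Ext_syzygy i (@pr_projective _ _ r 0) (j := kernel_val) (p := pr_aug r)) //.
split; [exact: kernel_val_inj | exact: kernel_exact | exact: pr_aug_surj].
Qed.

(** The right side mentions no projective resolution, so the choice in [Ext_eq0] is immaterial; the
    free one supplies existence. *)
Lemma Ext_eq0P i M : Ext_eq0 i.+1 M X <-> inj_Ext_eq0 i M.
Proof.
split=> [[r /res_ExtP] // | extM].
by exists (free_resolution M); apply/res_ExtP.
Qed.

End ExtVanishing.

(** * Infima of sets of natural numbers are attained when finite *)

Section InfNat.
Variable S : nat -> Prop.

(** The bound is an integer so as to cover [n - 1] when [n = 0]. *)
Lemma inf_nat_le_fin (n : int) :
  (inf_nat S <= n%:E)%E -> exists2 m : nat, m%:Z <= n & S m.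
Proof.
rewrite /inf_nat; case: pselect => // exS; rewrite lee_fin => le_n.
by exists (ex_minn exS) => //; case: ex_minnP => m /asboolP.
Qed.

Lemma inf_nat_fin (n : nat) : inf_nat S = n%:Z%:E -> S n.
Proof.
rewrite /inf_nat; case: pselect => // exS [<-].
by case: ex_minnP => m /asboolP.
Qed.

Lemma inf_nat_le (n : nat) : S n -> (inf_nat S <= n%:Z%:E)%E.
Proof.
move=> Sn; rewrite /inf_nat; case: pselect => [exS|[]]; last first.
  by exists n; apply/asboolP.
by rewrite lee_fin lez_nat; case: ex_minnP => m _; apply; apply/asboolP.
Qed.

End InfNat.

Theorem lemma2p29 (F : fieldType) (Lambda : falgType F)
  (A B C : lmodType Lambda^c)
  (hA : fin_gen A) (hB : fin_gen B) (hC : fin_gen C)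
  (f : {linear A -> B}) (g : {linear B -> C}) (hfg : short_exact f g)
  (k n : nat) (hk : (1 < k)%N)
  (hedell : (edell k A <= (n%:Z - 1)%:E)%E)
  (hdell : (dell (k - 1) B <= (n%:Z)%:E)%E) :
  (edell (k - 1) C <= (n%:Z)%:E)%E.
Proof.
have [a le_an edellA] := inf_nat_le_fin hedell.
have [b le_bn [N [K [L [_ KB LN sKL]]]]] := inf_nat_le_fin hdell.
(* As [a] is natural, [a <= n - 1] forces [n > 0]. *)
have {}le_an : (a < n)%N by lia.
have {}le_bn : (b <= n)%N by lia.
(* From here [k'] is one less than in the definition: the degree to kill is [n + k' + 1] and the
   injective dimension is [n + k + k' - 1]. *)
apply: inf_nat_le => -[//|k'] X _ idX.
have [I I0] := inf_nat_fin idX.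
rewrite addnS; apply/(Ext_eq0P I).
(* The connecting map lowers the index by one; [n > 0] leaves room for it. *)
have [m nE] : exists m, (n + k' = m.+1)%N by exists (n + k').-1; lia.
rewrite nE; apply: inj_Ext_ses hfg _ _.
  apply/Ext_eq0P; rewrite -nE.
  (* Taking [n + k' - a >= 1] as the parameter for [A] makes the injective dimension required by
     [edellA] that of [X]. *)
  have -> : (n + k' = a + (n + k' - a))%N by lia.
  by apply: edellA; [lia | rewrite idX; congr (Posz _)%:E; lia].
have -> : (m.+1 = n + k' - b + b)%N by lia.
apply/(inj_Ext_nth_syzygy I _ KB)/(inj_Ext_summand_up_to_proj sKL).
(* Cochains on [N] now take values in term [n + k' + k] of [I], just past the injective dimension,
   so the zero map bounds them. *)
apply/(inj_Ext_nth_syzygy I _ LN) => h _.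
exists (GRing.null_fun _) => x; rewrite linear0; apply/esym/I0; lia.
Qed.
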